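(* For every $\alpha\in\mathbb C$, the differential operator $$\Big(D_x+\frac{u_3}{u_2}\Big)\left(\frac{4u_2^2-u_1u_3}{u_1^{4\alpha-5}u_2^{5-\alpha}}D_x+D_x\frac{4u_2^2-u_1u_3}{u_1^{4\alpha-5}u_2^{5-\alpha}}\right)\Big(D_x-\frac{u_3}{u_2}\Big)D_x$$ is a recursion operator for the nonlocal Hunter-Saxton equation $u_t=2uu_x-D_x^{-1}u_x^2$.
   Context: $u$ is a scalar dependent variable, $u_k=\partial_x^ku$, $D_x=\sum_{k\ge0}u_{k+1}\,\partial/\partial u_k$, with formal inverse $D_x^{-1}$; functions act as multiplication operators and juxtaposition is composition (of formal pseudo-differential operators), on a domain where $u_1,u_2\ne0$ and branches of the powers are fixed. Put $K=2uu_1-D_x^{-1}u_1^2$, so $D_xK=2uu_2+u_1^2$, and $D_K=2uD_x+2u_1-2D_x^{-1}u_1D_x$ (its Fréchet derivative). For an operator $\Re$, $D_\Re[K]$ is the operator obtained by applying the derivation $\sum_kD_x^kK\,\partial/\partial u_k$ to each coefficient of $\Re$. $\Re$ is a recursion operator for $u_t=K$ if $L_K\Re:=D_\Re[K]-D_K\Re+\Re D_K=0$. *)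

(* Defs.v *)
From HB Require Import structures.
From mathcomp Require Import all_boot all_order all_algebra.
From mathcomp Require Import reals.
From mathcomp Require Export complex.

Set Implicit Arguments.
Unset Strict Implicit.
Unset Printing Implicit Defensive.

Import Order.TTheory GRing.Theory Num.Theory.
Local Open Scope ring_scope.

HB.mixin Record isDifferential B of GRing.ComNzRing B := {
  der : B -> B;
  derD : {morph der : a b / a + b};
  derM : forall a b, der (a * b) = der a * b + a * der b
}.

#[short(type="diffRingType")]
HB.structure Definition DiffRing := {B of GRing.ComNzRing B & isDifferential B}.

(* Algebras of differential functions of one scalar dependent variable u over  *)
(* a field of constants C.  [jet k] is u_k, [pder k] is the partial derivative *)
(* with respect to u_k, [der] is the total derivative D_x, and [jord f] is any *)
(* bound on the jet variables f depends on.  The elements u_1 and u_2 are      *)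
(* invertible and, for k = 1, 2, [jpow k a] is the fixed branch of u_k^a; the  *)
(* values of [jpow] at other k are irrelevant.                                 *)
(* Model: C = complex numbers, holomorphic functions of finitely many of the   *)
(* u_k on a domain of jet space on which u_1 and u_2 do not vanish and have    *)
(* logarithms l_1 and l_2, with jpow k a = exp (a * l_k).                      *)
HB.mixin Record isJetAlgebra (C : fieldType) A
    of GRing.ComUnitAlgebra C A & DiffRing A := {
  jet : nat -> A;
  pder : nat -> A -> A;
  jord : A -> nat;
  jpow : nat -> C -> A;
  pder_linear : forall k, linear (pder k);
  pderM : forall k f g, pder k (f * g) = pder k f * g + f * pder k g;
  pderC : forall j k f, pder j (pder k f) = pder k (pder j f);
  pder_jet : forall j k, pder j (jet k) = (j == k)%:R;
  pder_jord : forall f k, (jord f <= k)%N -> pder k f = 0;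
  der_jetE : forall f, der f = \sum_(k < jord f) jet k.+1 * pder k f;
  jet_unit : forall k, (0 < k < 3)%N -> jet k \is a GRing.unit;
  jpow1 : forall k, (0 < k < 3)%N -> jpow k 1 = jet k;
  jpowD : forall k, (0 < k < 3)%N -> forall a b : C,
    jpow k (a + b) = jpow k a * jpow k b;
  pder_jpow : forall k, (0 < k < 3)%N -> forall j (a : C),
    pder j (jpow k a) = if j == k then a *: jpow k (a - 1) else 0
}.

#[short(type="jetAlgType")]
HB.structure Definition JetAlgebra (C : fieldType) :=
  {A of GRing.ComUnitAlgebra C A & DiffRing A & isJetAlgebra C A}.

Arguments jet {C A} k : rename.
Arguments pder {C A} k f : rename.
Arguments jord {C A} f : rename.
Arguments jpow {C A} k a : rename.

Lemma der0 (B : diffRingType) : der (0 : B) = 0.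
Proof. by apply: (addrI (der (0 : B))); rewrite -derD !addr0. Qed.

Lemma der_jet (C : fieldType) (A : jetAlgType C) k :
  der (jet k : A) = jet k.+1.
Proof.
rewrite der_jetE; case: (ltnP k (jord (jet k : A))) => [lt_k | le_k].
  rewrite (bigD1 (Ordinal lt_k)) //= pder_jet eqxx mulr1 big1 ?addr0 // => i.
  by rewrite -val_eqE /= pder_jet => /negPf->; rewrite mulr0.
by have /eqP := pder_jord _ _ le_k; rewrite pder_jet eqxx oner_eq0.
Qed.

(* A[w] with D_x w = u_1^2: the formal variable w = 'X stands for the nonlocal *)
(* quantity D_x^{-1} u_1^2, and [loc] embeds the local functions.              *)
Definition nonlocal (C : fieldType) (A : jetAlgType C) : Type := {poly A}.

Section Nonlocal.
Variables (C : fieldType) (A : jetAlgType C).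
Notation NA := (nonlocal A).

HB.instance Definition _ := GRing.ComNzRing.copy NA {poly A}.

Definition loc (f : A) : NA := f%:P.
Definition w : NA := 'X.

Definition nonlocal_der (p : NA) : NA :=
  map_poly der (p : {poly A}) + (p : {poly A})^`() * (jet 1 ^+ 2)%:P.

Fact nonlocal_derD : {morph nonlocal_der : p q / p + q}.
Proof.
move=> p q; rewrite /nonlocal_der derivD mulrDl addrACA; congr (_ + _).
by apply/polyP => i; rewrite coefD !coef_map_id0 ?der0 // coefD derD.
Qed.

Fact nonlocal_derM p q :
  nonlocal_der (p * q) = nonlocal_der p * q + p * nonlocal_der q.
Proof.
rewrite /nonlocal_der derivM mulrDl.
have -> : map_poly der (p * q : {poly A}) =
    map_poly der (p : {poly A}) * q + p * map_poly der (q : {poly A}).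
  apply/polyP => i; rewrite coef_map_id0 ?der0 // coefD !coefM.
  rewrite (big_morph _ (@derD A) (der0 A)) -big_split; apply: eq_bigr => j _.
  by rewrite !coef_map_id0 ?der0 // derM.
rewrite mulrDr [(_ + _) * q]mulrDl addrACA; congr (_ + (_ + _)).
  by rewrite mulrAC.
by rewrite mulrA.
Qed.

HB.instance Definition _ :=
  isDifferential.Build NA nonlocal_derD nonlocal_derM.

Lemma der_loc f : der (loc f) = loc (der f).
Proof.
rewrite /der /= /nonlocal_der /loc derivC mul0r addr0.
by apply/polyP => i; rewrite coef_map_id0 ?der0 // !coefC; case: eqP; rewrite ?der0.
Qed.

Lemma der_w : der w = loc (jet 1 ^+ 2).
Proof.
rewrite /der /= /nonlocal_der /w derivX mul1r.
rewrite -[RHS]add0r; congr (_ + _); apply/polyP => i.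
rewrite coef_map_id0 ?der0 // coefX coef0.
case: eqP => _ /=; last exact: der0.
by apply: (addrI (der (1 : A))); rewrite addr0 -{3}[1]mulr1 derM mulr1 mul1r.
Qed.

(* The derivation \sum_k (D_x^k K) d/du_k on local functions. *)
Definition evol (K : NA) (f : A) : NA :=
  \sum_(k < jord f) iter k der K * loc (pder k f).

End Nonlocal.

Arguments loc {C A} f%_R.
Arguments w {C A}.

(* [Pdo n c] is the formal series \sum_(j >= 0) c_j D_x^(n - j).  One operator *)
(* has several representations (leading coefficients may vanish), so operators *)
(* are to be compared through [pdo_coef], the coefficient of D_x^i.            *)
Record pdo (B : Type) := Pdo { pdo_top : int; pdo_seq : nat -> B }.

Definition pdo_coef (B : nmodType) (P : pdo B) (i : int) : B :=
  if i <= pdo_top P then pdo_seq P `|pdo_top P - i|%N else 0.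

Definition pdo_is0 (B : nmodType) (P : pdo B) := forall i, pdo_coef P i = 0.

(* The binomial coefficient z (z - 1) ... (z - k + 1) / k! for integral z. *)
Definition binz (z : int) (k : nat) : int :=
  match z with
  | Posz n => 'C(n, k)%:Z
  | Negz n => (-1) ^+ k * 'C(n + k, k)%:Z
  end.

Definition pdo_map (B B' : Type) (f : B -> B') (P : pdo B) : pdo B' :=
  Pdo (pdo_top P) (f \o pdo_seq P).

Section PdoOps.
Variable B : diffRingType.
Implicit Types P Q : pdo B.

Definition pdo_add P Q : pdo B :=
  let n := Num.max (pdo_top P) (pdo_top Q) in
  Pdo n (fun j => pdo_coef P (n - j%:Z) + pdo_coef Q (n - j%:Z)).

Definition pdo_opp P : pdo B := pdo_map -%R P.

(* D_x^n b = \sum_k binz n k * (D_x^k b) D_x^(n - k) for every n : int. *)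
Definition pdo_mul P Q : pdo B :=
  Pdo (pdo_top P + pdo_top Q) (fun m =>
    \sum_(i < m.+1) \sum_(j < (m - i).+1)
      (pdo_seq P i * iter (m - i - j) der (pdo_seq Q j))
        *~ binz (pdo_top P - i%:Z) (m - i - j)).

Definition mulop (b : B) : pdo B := Pdo 0 (fun j => if j is 0 then b else 0).

Definition Dpow (n : int) : pdo B := Pdo n (fun j => if j is 0 then 1 else 0).

End PdoOps.

Arguments Dpow {B} n.
Notation Dx := (Dpow 1).
Notation Dxinv := (Dpow (-1)).

Declare Scope pdo_scope.
Delimit Scope pdo_scope with pdo.
Bind Scope pdo_scope with pdo.
Arguments mulop {B} b%_R.
Notation "P + Q" := (pdo_add P Q) : pdo_scope.
Notation "P - Q" := (pdo_add P (pdo_opp Q)) : pdo_scope.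
Notation "P * Q" := (pdo_mul P Q) : pdo_scope.

(* D_R[K] - D_K R + R D_K = 0, for R with local coefficients; DK is the        *)
(* Frechet derivative of K.                                                    *)
Definition recursion_operator (C : fieldType) (A : jetAlgType C)
    (K : nonlocal A) (DK : pdo (nonlocal A)) (R : pdo A) : Prop :=
  let R' := pdo_map loc R in
  pdo_is0 (pdo_map (evol K) R - DK * R' + R' * DK)%pdo.

Section HunterSaxton.
Variables (C : fieldType) (A : jetAlgType C).

Definition HS_K : nonlocal A := loc (2 * jet 0 * jet 1) - w.

Definition HS_DK : pdo (nonlocal A) :=
  (mulop (loc (2 * jet 0)) * Dx + mulop (loc (2 * jet 1))
   - mulop 2 * Dxinv * mulop (loc (jet 1)) * Dx)%pdo.

Lemma der_HS_K : der HS_K = loc (2 * jet 0 * jet 2 + jet 1 ^+ 2).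
Proof.
have derN (b : nonlocal A) : der (- b) = - der b.
  by apply: (addrI (der b)); rewrite -derD !subrr der0.
rewrite /HS_K derD derN der_loc der_w -[LHS]polyCB; congr (_%:P).
have der2 : der (2 : A) = 0.
  have der1 : der (1 : A) = 0.
    by apply: (addrI (der (1 : A))); rewrite addr0 -{3}[1]mulr1 derM mulr1 mul1r.
  by rewrite -[2]/(1 + 1) derD der1 addr0.
rewrite !derM der2 !der_jet mul0r add0r -mulrA -expr2 [2 * _ ^+ 2]mulr_natl mulr2n.
by rewrite addrAC addrK addrC.
Qed.

End HunterSaxton.

Arguments HS_K {C} A.
Arguments HS_DK {C} A.

(* Main.v *)
From mathcomp Require Import all_boot all_order all_algebra.
From mathcomp Require Import reals boolp.
From mathcomp Require Import zify ring.
Require Import Defs.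
Import Order.TTheory GRing.Theory Num.Theory.
Local Open Scope ring_scope.
Set Implicit Arguments.
Unset Strict Implicit.
Unset Printing Implicit Defensive.

(* Write d/dt for evolution along K and N_0 = 2 u D_x.  Since u_2 (D_x + g) =  *)
(* D_x u_2 for g = u_3 / u_2, one has D_K = 2 u D_x + 2 D_x^{-1} u_2 and the   *)
(* nonlocal terms cancel in each factor of R = (D_x + g) F (D_x - g) D_x:      *)
(* D_x intertwines d/dt - D_K with d/dt - B for B = D_x D_K D_x^{-1},          *)
(* D_x - g intertwines d/dt - B with d/dt - (N_0 + 4 u_1), F = f D_x + D_x f   *)
(* intertwines the latter with d/dt - (N_0 - 2 u_1), and D_x + g leads back to *)
(* d/dt - D_K.  The condition on F is df/dt = 2 u f' - 8 u_1 f, and the powers *)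
(* in f are balanced so that 7 - (4 alpha - 5) - 4 (5 - alpha) = -8.           *)

(** The intertwining relations are verified on coefficient families. Left multiplication by $D_x$
    becomes [dmul], a local operator acts by an explicit formula, and the relations become the
    computations [dsub_intertwines], [skew_intertwines] and [dadd_intertwines], assembled in
    [recursion_identity]. $D_x^{-1}$ is never expanded. Since the operator ends in $D_x$, the
    product with $D_K$ on its right only involves $D_xD_K=2uD_x^2+2u_1D_x+2u_2$ ([dmul_HS_DK]). On
    the other side, $u_1D_x(D_x+g)=D_x(u_1(D_x+g)-u_2)$ ([dmul_dadd]) evaluates the integral, and
    left cancellation of $D_x$ ([dmul_inj]) makes this legitimate. What depends on the equation is
    the evolution of $g$ and $f$ ([evol_g], [weight_f]). Both are built from $u_1,u_2,u_3$ only,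
    whose evolution is local because $D_xK$ is. *)

Lemma binzS (c : int) k : binz (c + 1) k.+1 = binz c k.+1 + binz c k.
Proof.
case: c => [n | [|n]].
- by rewrite -PoszD addn1 /= binS PoszD.
(* For $c=-1$ the index crosses from [Negz] to [Posz]: the left side is 0 and the two signs on the
   right cancel. *)
- by rewrite /= !binn exprS !mulr1 mulN1r addNr.
have -> : Negz n.+1 + 1 = Negz n by rewrite !NegzE; lia.
rewrite /= !addSn !addnS [in RHS]binS PoszD exprS; ring.
Qed.

Lemma sum_ord_trunc (V : nmodType) (F : nat -> V) m n :
    (m <= n)%N -> (forall k, (m <= k)%N -> F k = 0) ->
  \sum_(k < n) F k = \sum_(k < m) F k.
Proof.
move=> le_mn F0; rewrite -!(big_mkord xpredT F) (big_cat_nat _ le_mn) //=.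
rewrite [X in _ + X]big_nat_cond [X in _ + X]big1 ?addr0 //.
by move=> k /andP[/andP[/F0]].
Qed.

(** * Elementary consequences of the Leibniz rule *)

Section Derivations.
Variable B : diffRingType.
Implicit Types a b : B.

Lemma derN b : der (- b) = - der b.
Proof. by apply: (addrI (der b)); rewrite -derD !subrr der0. Qed.

Lemma der1 : der (1 : B) = 0.
Proof. by apply: (addrI (der 1)); rewrite addr0 -{3}[1]mulr1 derM mulr1 mul1r. Qed.

Lemma der_sum I (r : seq I) (P : pred I) (F : I -> B) :
  der (\sum_(i <- r | P i) F i) = \sum_(i <- r | P i) der (F i).
Proof. exact: (big_morph _ (@derD B) (der0 B)). Qed.

Lemma derMz b (z : int) : der (b *~ z) = der b *~ z.
Proof.
have derMn n : der (b *+ n) = der b *+ n.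
  by elim: n => [|n IHn]; rewrite ?der0 // !mulrS derD IHn.
by case: z => n; rewrite ?NegzE ?mulrNz ?derN -!pmulrn derMn.
Qed.

Lemma der_nat n : der (n%:R : B) = 0.
Proof. by rewrite [n%:R]pmulrn derMz der1 mul0rz. Qed.

Lemma iter_der0 k : iter k der (0 : B) = 0.
Proof. by elim: k => //= k ->; rewrite der0. Qed.

End Derivations.

(** * Formal pseudo-differential operators through their coefficients *)

Section Operators.
Variable B : diffRingType.
Implicit Types (P Q Z : pdo B) (y : int -> B) (b : B) (c i n : int).

(** This is $D_x\circ y$, from $D_xb=bD_x+b'$. Families are indexed by all of [int], so that the
    chosen top of a representation does not intervene. *)
Definition dmul y i := der (y i) + y (i - 1).

(* The coefficient of D^i in D^c y, truncated to N terms of the Leibniz series. *)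
Definition dpow N c y i := \sum_(k < N) iter k der (y (i - c + k%:Z)) *~ binz c k.

Lemma coef_gt_top P i : pdo_top P < i -> pdo_coef P i = 0.
Proof. by rewrite /pdo_coef leNgt => ->. Qed.

Lemma dpow_eq0 N c y i : (forall k, y (i - c + k%:Z) = 0) -> dpow N c y i = 0.
Proof. by move=> y0; rewrite /dpow big1 // => k _; rewrite y0 iter_der0 mul0rz. Qed.

Lemma dpow_coef_eq0 N c P i :
  pdo_top P + c < i -> dpow N c (pdo_coef P) i = 0.
Proof. by move=> ?; apply: dpow_eq0 => k; apply: coef_gt_top; lia. Qed.

Lemma dpow0 N y i : (0 < N)%N -> dpow N 0 y i = y i.
Proof.
by case: N => // N _; rewrite /dpow big_ord_recl /= subr0 addr0 big1 ?addr0.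
Qed.

(** $D_xD_x^c=D_x^{c+1}$, term by term from Pascal's rule [binzS]. The hypothesis kills the last
    differentiated term, which has no partner in the truncated sum. *)
Lemma dmul_dpow N c P i :
    pdo_top P + c < i - 1 + N%:Z ->
  dmul (dpow N c (pdo_coef P)) i = dpow N (c + 1) (pdo_coef P) i.
Proof.
case: N => [|N] ltN; first by rewrite /dmul /dpow !big_ord0 der0 addr0.
rewrite /dmul /dpow der_sum.
rewrite big_ord_recr /= [in X in _ + X = _]big_ord_recl [in RHS]big_ord_recl /=.
rewrite [X in _ + X + _ = _]derMz -iterS coef_gt_top; last by lia.
rewrite iter_der0 mul0rz addr0 addrCA.
have -> : i - 1 - c + 0 = i - (c + 1) + 0 by lia.
congr (_ + _); first by case: (c) => n //=; case: (Negz n + 1) => ? /=; rewrite ?bin0 ?expr0 ?mul1r.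
rewrite -big_split; apply: eq_bigr => k _ /=.
rewrite /bump /= add1n add0n binzS mulrzDr addrC derMz; congr (_ *~ _ + _ *~ _).
  by congr (der (iter k der (pdo_coef P _))); lia.
by congr (der (iter k der (pdo_coef P _))); lia.
Qed.

(** Surplus terms vanish because they involve coefficients above the top of [P] or of [Q]. The
    freedom in [n], [N], [M] lets several products be written over one range and compared term by
    term. *)
Lemma coef_mulE P Q n N M i :
    pdo_top P <= n -> n + pdo_top Q - i < N%:Z -> pdo_top P + pdo_top Q - i < M%:Z ->
  pdo_coef (P * Q)%pdo i =
    \sum_(a < N) pdo_coef P (n - a%:Z) * dpow M (n - a%:Z) (pdo_coef Q) i.
Proof.
set p := pdo_top P; set q := pdo_top Q => le_pn ltN ltM.
have [d Dn] : exists d : nat, n = p + d%:Z by exists `|n - p|%N; lia.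
pose G a := pdo_coef P (p - a%:Z) * dpow M (p - a%:Z) (pdo_coef Q) i.
have -> : \sum_(a < N) pdo_coef P (n - a%:Z) * dpow M (n - a%:Z) (pdo_coef Q) i
        = \sum_(a < N - d) G a.
  pose H a := pdo_coef P (n - a%:Z) * dpow M (n - a%:Z) (pdo_coef Q) i.
  have HG a : H (a + d)%N = G a.
    by rewrite /H /G; have -> : n - (a + d)%N%:Z = p - a%:Z by lia.
  have H0 a : (a < d)%N -> H a = 0.
    by move=> ltad; rewrite /H coef_gt_top ?mul0r // -/p; lia.
  rewrite -(big_mkord xpredT H) -(big_mkord xpredT G).
  have [le_dN | lt_Nd] := leqP d N; last first.
    rewrite [RHS]big_geq; last by lia.
    rewrite big_nat_cond big1 // => a /andP[/andP[_ ltaN] _].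
    by apply: H0; lia.
  rewrite (big_cat_nat _ le_dN) //= big_nat_cond big1 ?add0r; last first.
    by move=> a /andP[/andP[_ ltaN] _]; apply: H0.
  by rewrite -{1}[d]add0n big_addn; apply: eq_bigr => a _; rewrite HG.
rewrite {1}/pdo_coef /= -/p -/q; case: leP => [le_i | lt_i]; last first.
  by rewrite big1 // => a _; rewrite /G dpow_coef_eq0 ?mulr0 // -/q; lia.
set m := absz (p + q - i)%R; have Dm : m%:Z = p + q - i by rewrite /m; lia.
rewrite (@sum_ord_trunc _ G m.+1); last 2 first.
- by lia.
- by move=> a lea; rewrite /G dpow_coef_eq0 ?mulr0 // -/q; lia.
apply: eq_bigr => a _; rewrite /G.
have -> : pdo_coef P (p - a%:Z) = pdo_seq P a.
  by rewrite /pdo_coef -/p lerBlDr lerDl; congr pdo_seq; lia.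
have lea := ltn_ord a.
pose H k := iter k der (pdo_coef Q (i - (p - a%:Z) + k%:Z)) *~ binz (p - a%:Z) k.
rewrite /dpow (@sum_ord_trunc _ H (m - a).+1) /H; last 2 first.
- by lia.
- by move=> k lek; rewrite coef_gt_top ?iter_der0 ?mul0rz // -/q; lia.
(* [pdo_mul] sums over the position in [Q]; after reversal the index is the Leibniz order, as in
   [dpow]. *)
rewrite (reindex_inj rev_ord_inj) big_distrr; apply: eq_bigr => k _ /=.
have lek := ltn_ord k.
rewrite subSS (_ : m - a - (m - a - k) = k)%N; last by lia.
rewrite mulrzAr; congr (_ * iter k der _ *~ _).
rewrite /pdo_coef -/q ifT; last by lia.
by congr pdo_seq; lia.
Qed.

Lemma coef_mul_congr P P' Q Q' :
    pdo_coef P = pdo_coef P' -> pdo_coef Q = pdo_coef Q' ->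
  pdo_coef (P * Q)%pdo = pdo_coef (P' * Q')%pdo.
Proof.
move=> eqP eqQ; apply: funext => i.
pose n := Num.max (pdo_top P) (pdo_top P').
pose N := (`|n| + `|pdo_top Q| + `|pdo_top Q'| + `|i|).+1%N.
rewrite (@coef_mulE P Q n N N) ?(@coef_mulE P' Q' n N N) ?eqP ?eqQ //;
  rewrite /N /n; lia.
Qed.

Lemma coef_add P Q i : pdo_coef (P + Q)%pdo i = pdo_coef P i + pdo_coef Q i.
Proof.
rewrite {1}/pdo_coef /=; case: leP => [le_i | lt_i].
  by have -> : Num.max (pdo_top P) (pdo_top Q) -
     `|Num.max (pdo_top P) (pdo_top Q) - i|%N%:Z = i by lia.
by rewrite !coef_gt_top ?addr0 //; lia.
Qed.

Lemma coef_opp P i : pdo_coef (pdo_opp P) i = - pdo_coef P i.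
Proof. by rewrite /pdo_coef /=; case: ifP; rewrite ?oppr0. Qed.

Lemma coef_mulDl P Q Z i :
  pdo_coef ((P + Q) * Z)%pdo i = pdo_coef (P * Z)%pdo i + pdo_coef (Q * Z)%pdo i.
Proof.
pose n := Num.max (pdo_top P) (pdo_top Q).
pose N := (`|n| + `|pdo_top Z| + `|i|).+1%N.
rewrite (@coef_mulE (P + Q)%pdo Z n N N) ?(@coef_mulE P Z n N N)
  ?(@coef_mulE Q Z n N N); try by rewrite /N /n /=; lia.
by rewrite -big_split; apply: eq_bigr => a _; rewrite coef_add mulrDl.
Qed.

Lemma coef_mulNl P Z i :
  pdo_coef (pdo_opp P * Z)%pdo i = - pdo_coef (P * Z)%pdo i.
Proof.
pose N := (`|pdo_top P| + `|pdo_top Z| + `|i|).+1%N.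
rewrite (@coef_mulE (pdo_opp P) Z (pdo_top P) N N)
  ?(@coef_mulE P Z (pdo_top P) N N); try by rewrite /N /=; lia.
by rewrite -sumrN; apply: eq_bigr => a _; rewrite coef_opp mulNr.
Qed.

Lemma coef_Dpow n i : pdo_coef (Dpow n : pdo B) i = (i == n)%:R.
Proof.
rewrite /pdo_coef /=; case: leP => [le_i | lt_i]; last by rewrite gt_eqF.
case: eqVneq => [-> | ne_i]; first by rewrite subrr.
by case E: `|n - i|%N => [|k] //; lia.
Qed.

Lemma coef_mulop b i : pdo_coef (mulop b) i = b * (i == 0)%:R.
Proof.
rewrite /pdo_coef /=; case: leP => [le_i | lt_i]; last by rewrite gt_eqF ?mulr0.
case: eqVneq => [-> | ne_i]; first by rewrite mulr1.
by case E: `|0 - i|%N => [|k]; [lia | rewrite mulr0].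
Qed.

Lemma coef_Dpow_mul n P N i :
    n + pdo_top P - i < N%:Z ->
  pdo_coef (Dpow n * P)%pdo i = dpow N n (pdo_coef P) i.
Proof.
move=> ltN; rewrite (@coef_mulE (Dpow n) P n N.+1 N) //; last by rewrite /=; lia.
rewrite big_ord_recl /= subr0 coef_Dpow eqxx mul1r big1 ?addr0 // => a _.
by rewrite coef_Dpow /bump /= add1n [_ == _](_ : _ = false) ?mul0r //; lia.
Qed.

Lemma coef_Dx_mul P : pdo_coef (Dx * P)%pdo = dmul (pdo_coef P).
Proof.
apply: funext => i; pose N := (`|pdo_top P| + `|i|).+3%N.
rewrite (@coef_Dpow_mul 1 P N); last by rewrite /N; lia.
rewrite -[1 in LHS]add0r -dmul_dpow; last by rewrite /N; lia.
by rewrite /dmul !dpow0.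
Qed.

(** The case $c=-1$ of [dmul_dpow]. Together with [dmul_inj] it characterises left multiplication by
    $D_x^{-1}$. *)
Lemma coef_Dx_Dxinv_mul P : dmul (pdo_coef (Dxinv * P)%pdo) = pdo_coef P.
Proof.
apply: funext => i; pose N := (`|pdo_top P| + `|i|).+3%N.
rewrite {1}/dmul !(@coef_Dpow_mul (-1) P N); try by rewrite /N; lia.
rewrite -[LHS]/(dmul (dpow N (-1) (pdo_coef P)) i) dmul_dpow; last by rewrite /N; lia.
by rewrite addNr dpow0.
Qed.

Lemma coef_mulop_mul b P i : pdo_coef (mulop b * P)%pdo i = b * pdo_coef P i.
Proof.
pose N := (`|pdo_top P| + `|i|).+1%N.
rewrite (@coef_mulE _ _ 0 N.+1 N); try by rewrite /N /=; lia.
rewrite big_ord_recl /= subr0 coef_mulop eqxx mulr1 dpow0 // big1 ?addr0 // => a _.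
by rewrite coef_mulop mulr0 mul0r.
Qed.

(** Descending induction: above both tops everything vanishes, and equal coefficients at $i$ force
    equal ones at $i-1$. Boundedness of the order from above is essential. *)
Lemma dmul_inj P Q :
  dmul (pdo_coef P) = dmul (pdo_coef Q) -> pdo_coef P = pdo_coef Q.
Proof.
move=> eqD; apply: funext => i.
pose n := Num.max (pdo_top P) (pdo_top Q) + 1.
have E k : pdo_coef P (n - k%:Z) = pdo_coef Q (n - k%:Z).
  elim: k => [|k IHk]; first by rewrite !coef_gt_top //; rewrite /n; lia.
  have := congr1 (@^~ (n - k%:Z)) eqD; rewrite /dmul /= IHk => /addrI.
  by have -> : n - k%:Z - 1 = n - k.+1%:Z by lia.
have [le_i | lt_i] := leP i n; last by rewrite !coef_gt_top //; rewrite /n in lt_i; lia.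
by have := E `|n - i|%N; have -> : n - `|n - i|%N%:Z = i by lia.
Qed.

(* [pdo_mul] is in fact associative, but membership in the left nucleus passes *)
(* to sums and products, so D_x, D_x^{-1} and functions suffice.               *)
Definition nuclear P :=
  forall Q Z, pdo_coef (P * Q * Z)%pdo = pdo_coef (P * (Q * Z))%pdo.

Lemma nuclear_mulop b : nuclear (mulop b).
Proof.
move=> Q Z; apply: funext => i; rewrite coef_mulop_mul.
pose N := (`|pdo_top Q| + `|pdo_top Z| + `|i|).+1%N.
rewrite (@coef_mulE _ Z (pdo_top Q) N N) ?(@coef_mulE Q Z (pdo_top Q) N N);
  try by rewrite /N /=; lia.
by rewrite big_distrr; apply: eq_bigr => a _; rewrite coef_mulop_mul -mulrA.
Qed.

Lemma nuclear_Dx : nuclear Dx.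
Proof.
move=> Q Z; apply: funext => i; rewrite coef_Dx_mul.
pose n := pdo_top Q + 1; pose N := (`|n| + `|pdo_top Z| + `|i|).+3%N.
rewrite /dmul !(@coef_mulE Q Z n N N) ?(@coef_mulE _ Z n N N);
  try by rewrite /N /n /=; lia.
rewrite coef_Dx_mul.
pose T a := pdo_coef Q (n - a%:Z) * dpow N (n - a%:Z + 1) (pdo_coef Z) i.
have -> : \sum_(a < N) dmul (pdo_coef Q) (n - a%:Z) * dpow N (n - a%:Z) (pdo_coef Z) i
  = \sum_(a < N) der (pdo_coef Q (n - a%:Z)) * dpow N (n - a%:Z) (pdo_coef Z) i
    + \sum_(a < N) T a.+1.
  rewrite -big_split; apply: eq_bigr => a _; rewrite /dmul mulrDl /T.
  by have [-> ->] : n - a.+1%:Z = n - a%:Z - 1 /\ n - a%:Z - 1 + 1 = n - a%:Z by split; lia.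
(* The shift is harmless because both end terms vanish: [n] is one above the top of [Q], and at [N]
   the order is too low to reach $D_x^i$. *)
have -> : \sum_(a < N) T a.+1 = \sum_(a < N) T a.
  have T0 : T 0 = 0 by rewrite /T coef_gt_top ?mul0r //; rewrite /n; lia.
  have TN : T N = 0 by rewrite /T dpow_coef_eq0 ?mulr0 //; rewrite /N /n; lia.
  have := @big_ord_recl _ 0 +%R N (fun a : 'I_N.+1 => T a).
  by rewrite big_ord_recr /= TN T0 addr0 add0r.
rewrite der_sum -!big_split; apply: eq_bigr => a _ /=.
by rewrite /T -dmul_dpow ?derM /dmul; [ring | rewrite /N /n; lia].
Qed.

(** After multiplication by $D_x$ on the left, which is injective, both sides become $QZ$. *)
Lemma nuclear_Dxinv : nuclear Dxinv.
Proof.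
move=> Q Z; apply: dmul_inj; rewrite coef_Dx_Dxinv_mul -coef_Dx_mul -nuclear_Dx.
by apply: coef_mul_congr => //; rewrite coef_Dx_mul coef_Dx_Dxinv_mul.
Qed.

Lemma nuclear_mul P Q : nuclear P -> nuclear Q -> nuclear (P * Q)%pdo.
Proof.
move=> nP nQ Y Z; rewrite nP -(coef_mul_congr (esym (nP Q Y)) (erefl (pdo_coef Z))).
by rewrite nP; apply: coef_mul_congr.
Qed.

Lemma nuclear_add P Q : nuclear P -> nuclear Q -> nuclear (P + Q)%pdo.
Proof.
move=> nP nQ Y Z; apply: funext => i; rewrite coef_mulDl -nP -nQ -coef_mulDl.
by congr (_ i); apply: coef_mul_congr => //; apply: funext => j; rewrite coef_mulDl coef_add.
Qed.

Lemma nuclear_opp P : nuclear P -> nuclear (pdo_opp P).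
Proof.
move=> nP Y Z; apply: funext => i; rewrite coef_mulNl -nP -coef_mulNl.
by congr (_ i); apply: coef_mul_congr => //; apply: funext => j; rewrite coef_mulNl coef_opp.
Qed.

End Operators.

(** * Applying morphisms and derivations to coefficients *)

Section PdoMap.
Variables (B B' : diffRingType) (h : B -> B').
Hypotheses (h0 : h 0 = 0) (hD : {morph h : a b / a + b}).

Let hsum I (r : seq I) (F : I -> B) :
  h (\sum_(i <- r) F i) = \sum_(i <- r) h (F i).
Proof. exact: (big_morph _ hD h0). Qed.

Let hMz b z : h (b *~ z) = h b *~ z.
Proof.
have hN x : h (- x) = - h x by apply: (addrI (h x)); rewrite -hD !subrr.
have hMn n : h (b *+ n) = h b *+ n.
  by elim: n => [|n IHn]; rewrite ?h0 // !mulrS hD IHn.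
by case: z => n; rewrite ?NegzE ?mulrNz ?hN -!pmulrn hMn.
Qed.

Lemma coef_map_pdo P i : pdo_coef (pdo_map h P) i = h (pdo_coef P i).
Proof. by rewrite /pdo_coef /=; case: ifP. Qed.

Lemma coef_map_add P Q i :
  pdo_coef (pdo_map h (P + Q)%pdo) i = pdo_coef (pdo_map h P + pdo_map h Q)%pdo i.
Proof. by rewrite coef_map_pdo !coef_add !coef_map_pdo hD. Qed.

Lemma coef_map_mulop b i :
  pdo_coef (pdo_map h (mulop b)) i = pdo_coef (mulop (h b)) i.
Proof.
by rewrite coef_map_pdo /pdo_coef /=; case: ifP => // _; case: absz.
Qed.

(** Commuting with [der] lets [h] and [l] pass through the derivatives in the Leibniz series. For
    [h] an evolution and [l] the embedding [loc], this is the product rule for $D_{PQ}[K]$. *)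
Lemma coef_map_derivation (l : B -> B') P Q i :
    {morph h : b / der b} -> {morph l : b / der b} ->
    (forall a b, h (a * b) = h a * l b + l a * h b) ->
  pdo_coef (pdo_map h (P * Q)%pdo) i =
    pdo_coef (pdo_map h P * pdo_map l Q)%pdo i
    + pdo_coef (pdo_map l P * pdo_map h Q)%pdo i.
Proof.
move=> hder lder hM; rewrite /pdo_coef /=; case: ifP => _; last by rewrite addr0.
have it (f : B -> B') k b : {morph f : x / der x} -> f (iter k der b) = iter k der (f b).
  by move=> fder; elim: k => //= k <-.
rewrite hsum -big_split; apply: eq_bigr => a _ /=.
rewrite hsum -big_split; apply: eq_bigr => k _ /=.
by rewrite hMz hM !it // mulrzDl.
Qed.

Lemma coef_map_morph P Q i :
    {morph h : b / der b} -> {morph h : a b / a * b} ->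
  pdo_coef (pdo_map h (P * Q)%pdo) i = pdo_coef (pdo_map h P * pdo_map h Q)%pdo i.
Proof.
move=> hder hM; rewrite /pdo_coef /=; case: ifP => // _.
have it k b : h (iter k der b) = iter k der (h b) by elim: k => //= k <-.
rewrite hsum; apply: eq_bigr => a _; rewrite hsum; apply: eq_bigr => k _.
by rewrite hMz hM it.
Qed.

End PdoMap.

(** * The evolutionary derivation along $K$ *)

Section Evolution.
Variables (C : fieldType) (A : jetAlgType C).
Implicit Types (f g : A) (K : nonlocal A) (a c : C).

Lemma locD : {morph @loc C A : f g / f + g}.
Proof. by move=> f g; rewrite /loc polyCD. Qed.

Lemma locM : {morph @loc C A : f g / f * g}.
Proof. by move=> f g; rewrite /loc polyCM. Qed.

Lemma loc0 : loc (0 : A) = 0. Proof. by []. Qed.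

Lemma locN f : loc (- f) = - loc f.
Proof. by apply: (addrI (loc f)); rewrite -locD !subrr. Qed.

Lemma loc_nat n : loc (n%:R : A) = n%:R.
Proof. by elim: n => // n IHn; rewrite !mulrS locD IHn. Qed.

(** [jord] is merely some bound, so sums attached to different functions must first be brought to a
    common range. *)
Lemma sum_pder (N : nat) f (x : nat -> nonlocal A) :
    (forall k, (N <= k)%N -> pder k f = 0) ->
  \sum_(k < jord f) x k * loc (pder k f) = \sum_(k < N) x k * loc (pder k f).
Proof.
move=> f0; pose F k := x k * loc (pder k f).
rewrite -/(F _) -(@sum_ord_trunc _ F (jord f) (maxn N (jord f))) ?leq_maxr //; last first.
  by move=> k /pder_jord fk0; rewrite /F fk0 loc0 mulr0.
rewrite (@sum_ord_trunc _ F N) ?leq_maxl // => k /f0 fk0.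
by rewrite /F fk0 loc0 mulr0.
Qed.

Lemma evolE K f N : (forall k, (N <= k)%N -> pder k f = 0) ->
  evol K f = \sum_(k < N) iter k der K * loc (pder k f).
Proof. exact: sum_pder. Qed.

Lemma loc_derE f N : (forall k, (N <= k)%N -> pder k f = 0) ->
  loc (der f) = \sum_(k < N) loc (jet k.+1) * loc (pder k f).
Proof.
move=> f0; rewrite der_jetE (big_morph _ locD loc0) -(sum_pder (fun k => loc (jet k.+1)) f0).
by apply: eq_bigr => k _; rewrite locM.
Qed.

Lemma pderD k f g : pder k (f + g) = pder k f + pder k g.
Proof. by have := pder_linear k 1 f g; rewrite !scale1r. Qed.

Lemma pder0 k : pder k (0 : A) = 0.
Proof. by apply: (addrI (pder k (0 : A))); rewrite -pderD !addr0. Qed.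

Lemma evolD K : {morph evol K : f g / f + g}.
Proof.
move=> f g; pose N := maxn (jord f) (jord g).
have f0 k : (N <= k)%N -> pder k f = 0 by rewrite geq_max => /andP[/pder_jord].
have g0 k : (N <= k)%N -> pder k g = 0 by rewrite geq_max => /andP[_ /pder_jord].
rewrite (evolE K f0) (evolE K g0) (@evolE K _ N) => [|k le_k]; last first.
  by rewrite pderD f0 ?g0 ?addr0.
by rewrite -big_split; apply: eq_bigr => k _; rewrite pderD locD mulrDr.
Qed.

Lemma evol0 K : evol K 0 = 0.
Proof. by apply: (addrI (evol K 0)); rewrite -evolD !addr0. Qed.

Lemma evolN K f : evol K (- f) = - evol K f.
Proof. by apply: (addrI (evol K f)); rewrite -evolD !subrr evol0. Qed.

Lemma evolM K f g : evol K (f * g) = evol K f * loc g + loc f * evol K g.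
Proof.
pose N := maxn (jord f) (jord g).
have f0 k : (N <= k)%N -> pder k f = 0 by rewrite geq_max => /andP[/pder_jord].
have g0 k : (N <= k)%N -> pder k g = 0 by rewrite geq_max => /andP[_ /pder_jord].
rewrite (evolE K f0) (evolE K g0) (@evolE K _ N) => [|k le_k]; last first.
  by rewrite pderM f0 ?g0 // mul0r mulr0 addr0.
rewrite big_distrl big_distrr -big_split; apply: eq_bigr => k _ /=.
by rewrite pderM locD !locM; ring.
Qed.

Lemma evol1 K : evol K 1 = 0.
Proof.
by apply: (addrI (evol K 1)); rewrite addr0 -{3}[1]mulr1 evolM mulr1 mul1r.
Qed.

Lemma evol_nat K n : evol K n%:R = 0.
Proof. by elim: n => [|n IHn]; rewrite ?evol0 // mulrS evolD evol1 IHn addr0. Qed.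

Lemma evol_jet K k : evol K (jet k) = iter k der K.
Proof.
rewrite (@evolE K _ k.+1) => [|j lt_kj]; last first.
  by rewrite pder_jet; case: eqP lt_kj => // ->; rewrite ltnn.
rewrite big_ord_recr /= pder_jet eqxx loc_nat mulr1 big1 ?add0r // => j _.
by rewrite pder_jet ltn_eqF // loc0 mulr0.
Qed.

Lemma evol_jpow K k a : (0 < k < 3)%N ->
  evol K (jpow k a) = iter k der K * loc (a *: jpow k (a - 1)).
Proof.
move=> k_in; rewrite (@evolE K _ k.+1) => [|j lt_kj]; last first.
  by rewrite pder_jpow //; case: eqP lt_kj => // ->; rewrite ltnn.
rewrite big_ord_recr /= pder_jpow // eqxx big1 ?add0r // => j _.
by rewrite pder_jpow // ltn_eqF // loc0 mulr0.
Qed.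

Lemma der_jpow k a : (0 < k < 3)%N ->
  der (jpow k a : A) = jet k.+1 * (a *: jpow k (a - 1)).
Proof.
move=> k_in; apply: (@polyC_inj A); rewrite -/(loc _) (@loc_derE _ k.+1) => [|j lt_kj]; last first.
  by rewrite pder_jpow //; case: eqP lt_kj => // ->; rewrite ltnn.
rewrite big_ord_recr /= pder_jpow // eqxx big1 ?add0r -?locM // => j _.
by rewrite pder_jpow // ltn_eqF // loc0 mulr0.
Qed.

(** $[\partial_{u_k},D_x]=\partial_{u_{k-1}}$: the extra term comes from differentiating the
    coefficient $u_k$ of $\partial_{u_{k-1}}$ in $D_x$. *)
Lemma pder_der k f :
  pder k (der f) = der (pder k f) + (if k is k'.+1 then pder k' f else 0).
Proof.
have pder_sum (r : seq nat) (F : nat -> A) :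
    pder k (\sum_(j <- r) F j) = \sum_(j <- r) pder k (F j).
  exact: (big_morph _ (pderD k) (pder0 k)).
apply: (@polyC_inj A); rewrite polyCD -!/(loc _) (@loc_derE (pder k f) (jord f)); last first.
  by move=> j /pder_jord f0; rewrite pderC f0 pder0.
rewrite der_jetE -(big_mkord xpredT (fun j => jet j.+1 * pder j f)) pder_sum.
rewrite big_mkord (big_morph _ locD loc0).
under eq_bigr => j _ do rewrite pderM pder_jet [pder k (pder j f)]pderC locD !locM loc_nat.
rewrite big_split addrC; congr (_ + _) => /=.
case: k {pder_sum} => [|k]; first by rewrite big1 // => j _; rewrite mul0r.
have [lt_k | le_k] := ltnP k (jord f); last first.
  rewrite pder_jord // big1 // => j _.
  by rewrite eqSS gtn_eqF ?mul0r // (leq_trans (ltn_ord j)).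
rewrite (bigD1 (Ordinal lt_k)) //= eqxx mul1r big1 ?addr0 // => j.
by rewrite -val_eqE eqSS eq_sym /= => /negPf->; rewrite mul0r.
Qed.

(** The extra term of [pder_der] supplies exactly the $D_x^{k+1}K$ produced when $D_x$ hits
    $D_x^kK$. *)
Lemma evol_der K : {morph evol K : f / der f}.
Proof.
move=> f; set N := jord f.
have f0 k : (N <= k)%N -> pder k f = 0 by exact: pder_jord.
rewrite (@evolE K (der f) N.+1) => [|[//|k] lt_k]; last first.
  by rewrite pder_der !f0 ?der0 ?addr0 // ltnW.
rewrite (evolE K f0) der_sum big_ord_recl /= pder_der addr0.
under eq_bigr => k _ do rewrite /bump /= add1n pder_der locD mulrDr.
rewrite big_split /=.
have -> : \sum_(k < N) der (iter k der K * loc (pder k f)) =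
  \sum_(k < N) iter k der K * loc (der (pder k f)) +
  \sum_(k < N) der (iter k der K) * loc (pder k f).
  by rewrite -big_split; apply: eq_bigr => k _; rewrite derM der_loc addrC.
rewrite addrA; congr (_ + _).
have := @big_ord_recl _ 0 +%R N (fun k : 'I_N.+1 => iter k der K * loc (der (pder k f))).
rewrite big_ord_recr /= f0 // der0 loc0 mulr0 addr0 => ->.
by [].
Qed.

End Evolution.

(** * Weights of $u_1$, $u_2$ and of the coefficient $f$ *)

Section Weights.
Variables (C : fieldType) (A : jetAlgType C).
Implicit Types (f g v : A).
Notation u := (jet 0 : A).
Notation u1 := (jet 1 : A).
Notation u2 := (jet 2 : A).
Notation u3 := (jet 3 : A).
Notation ev := (evol (HS_K A)).

(* d/dt - 2 u D_x is a derivation, so the eigenvalues c u_1 add up in products. *)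
Definition weight (c f : A) := ev f = loc (2 * u * der f + c * u1 * f).

Lemma evol_jet2 : ev u2 = loc (2 * u * u3 + 4 * u1 * u2).
Proof.
rewrite evol_jet /= der_HS_K der_loc; congr loc.
rewrite expr2 !(der_nat, derD, derM, der_jet); ring.
Qed.

Lemma evol_jet3 : ev u3 = loc (2 * u * jet 4 + 6 * u1 * u3 + 4 * u2 ^+ 2).
Proof.
rewrite evol_jet -[iter _ _ _]/(der (iter 2 der (HS_K A))) -evol_jet evol_jet2.
rewrite der_loc; congr loc; rewrite !(der_nat, derD, derM, der_jet); ring.
Qed.

Lemma weightM c c' f g : weight c f -> weight c' g -> weight (c + c') (f * g).
Proof.
move=> wf wg; rewrite /weight evolM wf wg -!locM -locD derM; congr loc; ring.
Qed.

(** Both $D_x$ and the evolution are derivations, hence determined on $f^{-1}$ by $ff^{-1}=1$. *)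
Lemma weightV c f : f \is a GRing.unit -> weight c f -> weight (- c) f^-1.
Proof.
move=> fU wf; have fV := divrr fU; set v := f^-1 in fV *.
have dv : der v = - (v * der f * v).
  have := congr1 der fV; rewrite derM der1 => E.
  have -> : der v = der v * (f * v) by rewrite fV mulr1.
  have -> : der v * (f * v) = (der f * v + f * der v) * v - v * der f * v by ring.
  by rewrite E mul0r add0r.
have := congr1 ev fV; rewrite evolM evol1 => E.
have -> : weight (- c) v = (ev v = loc (2 * u * der v + - c * u1 * v)) by [].
have -> : ev v = ev v * (loc f * loc v) by rewrite -locM fV mulr1.
have -> : ev v * (loc f * loc v) =
  (ev f * loc v + loc f * ev v) * loc v - loc v * ev f * loc v by ring.
rewrite E mul0r add0r wf -!locM -locN dv; congr loc.
have -> : - c * u1 * v = - c * u1 * v * (f * v) by rewrite fV mulr1.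
ring.
Qed.

Lemma jpowS k a : (0 < k < 3)%N -> jet k * jpow k (a - 1) = jpow k a :> A.
Proof. by move=> k_in; rewrite -(jpow1 _ k_in) -jpowD // addrC subrK. Qed.

Lemma jpow0 k : (0 < k < 3)%N -> jpow k 0 = 1 :> A.
Proof.
move=> k_in; have jU := @jet_unit C A k k_in.
by apply: (mulrI jU); rewrite -{1}(jpow1 _ k_in) -jpowD // addr0 jpow1 // mulr1.
Qed.

Lemma jpow_unit k a : (0 < k < 3)%N -> (jpow k a : A) \is a GRing.unit.
Proof.
move=> k_in; apply/unitrPr; exists (jpow k (- a)).
by rewrite -jpowD // subrr jpow0.
Qed.

Lemma weight_jpow1 a : weight a%:A (jpow 1 a).
Proof.
rewrite /weight evol_jpow // [iter _ _ _]der_HS_K -locM der_jpow //; congr loc.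
rewrite -(@jpowS 1 a) // -![a *: jpow _ _]mulr_algl; ring.
Qed.

Lemma weight_jpow2 a : weight (4 * a%:A) (jpow 2 a).
Proof.
rewrite /weight evol_jpow // -evol_jet evol_jet2 -locM der_jpow //; congr loc.
rewrite -(@jpowS 2 a) // -![a *: jpow _ _]mulr_algl; ring.
Qed.

Lemma weight_jet2V : weight (- 4) u2^-1.
Proof.
apply: weightV; first exact: jet_unit.
by rewrite /weight evol_jet2 der_jet.
Qed.

(** $u_1u_3$ has weight 7 up to a defect $4u_1u_2^2$, while $u_2^2$ has weight 8. The combination
    $cu_2^2-u_1u_3$ has weight 7 when $8c-4=7c$, that is $c=4$. *)
Lemma weight_numerator : weight 7 (4 * u2 ^+ 2 - u1 * u3).
Proof.
rewrite /weight expr2 evolD evolN !evolM evol_nat mul0r add0r evol_jet2 evol_jet3.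
rewrite evol_jet [iter _ _ _]der_HS_K -!(locM, locN, locD); congr loc.
rewrite !(der_nat, derD, derN, derM, der_jet); ring.
Qed.

Lemma weight_f (alpha : C) : weight (- 8)
  ((4 * u2 ^+ 2 - u1 * u3) / (jpow 1 (4 * alpha - 5) * jpow 2 (5 - alpha))).
Proof.
have -> : - 8 = 7 - ((4 * alpha - 5)%:A + 4 * (5 - alpha)%:A) :> A.
  rewrite -![_%:A]/(in_alg A _) !(rmorphB, rmorphM, rmorph_nat) /=; ring.
apply: weightM weight_numerator (weightV _ _); first by rewrite unitrM !jpow_unit.
exact: weightM (weight_jpow1 _) (weight_jpow2 _).
Qed.

(** Conceptually, $g$ is the logarithmic derivative of $u_2$, which has weight 4, so its evolution
    is $D_x(2ug+4u_1)$. *)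
Lemma evol_g : let g := u3 / u2 in ev g = loc (2 * u * der g + 2 * u1 * g + 4 * u2).
Proof.
have u2V := divrr (@jet_unit C A 2 isT).
rewrite /= evolM evol_jet3 weight_jet2V -!locM -locD derM der_jet; congr loc.
have -> : 4 * u2 = 4 * u2 * (u2 / u2) by rewrite u2V mulr1.
ring.
Qed.

End Weights.

(** * The intertwining identities on coefficient families *)

Section Intertwining.
Variables (B : diffRingType) (u f g : B).
Implicit Types y v : int -> B.

Definition dadd y i := dmul y i + g * y i.
Definition dsub y i := dmul y i - g * y i.
(** The action of $aD_x+D_xa$, with $a$ left free so that $f$ and its evolution can both be
    inserted. *)
Definition skew (a : B) y i := a * dmul y i + dmul (fun j => a * y j) i.

Notation u1 := (der u).
Notation u2 := (der u1).
Hypothesis gu2 : g * u2 = der u2.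

Let gt := 2 * u * der g + 2 * u1 * g + 4 * u2.
Let ft := 2 * u * der f - 8 * u1 * f.

Let derE := (@der_nat B, @derD B, @derN B, @derM B).

(** The term $2u_2y$ is nonlocal in $x=D_xy$, but $(D_x-g)u_2y=u_2x$ because $gu_2=u_3$. *)
Lemma dsub_intertwines y : let x := dmul y in let w := dsub x in
  dsub (fun i => 2 * u * dmul x i + 2 * u1 * x i + 2 * u2 * y i)
  = fun i => gt * x i + (2 * u * dmul w i + 4 * u1 * w i).
Proof.
apply: funext => i /=; rewrite /dsub /gt /dmul !derE -gu2; ring.
Qed.

(** With $F=2fD_x+f'$, the coefficient of $D_x$ dictates [ft]; the terms of order zero then
    balance. *)
Lemma skew_intertwines v :
  (fun i => skew ft v i + skew f (fun i => 2 * u * dmul v i + 4 * u1 * v i) i)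
  = fun i => 2 * u * dmul (skew f v) i - 2 * u1 * skew f v i.
Proof. apply: funext => i; rewrite /skew /ft /dmul !derE; ring. Qed.

(** The right side is $D_K(D_x+g)v$ with its integral evaluated: $u_2v$ stands for
    $D_x^{-1}u_2(D_x+g)v$. *)
Lemma dadd_intertwines v :
  (fun i => gt * v i + dadd (fun i => 2 * u * dmul v i - 2 * u1 * v i) i)
  = fun i => 2 * u * dmul (dadd v) i + 2 * u2 * v i.
Proof. apply: funext => i; rewrite /dadd /gt /dmul !derE; ring. Qed.

Lemma recursion_identity y i :
    let x := dmul y in let w := dsub x in let v := skew f w in
  gt * v i + dadd (skew ft w) i - dadd (skew f (fun j => gt * x j)) i
  - (2 * u * dmul (dadd v) i + 2 * u2 * v i)
  + dadd (skew f (dsub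
      (fun i => 2 * u * dmul x i + 2 * u1 * x i + 2 * u2 * y i))) i = 0.
Proof.
move=> x w v; rewrite dsub_intertwines -/x -/w.
have skewD a b : skew f (fun j => a j + b j) = fun j => skew f a j + skew f b j.
  by apply: funext => j; rewrite /skew /dmul !derE; ring.
have daddD a b j : dadd (fun j => a j + b j) j = dadd a j + dadd b j.
  by rewrite /dadd /dmul !derE; ring.
rewrite skewD (daddD (skew f _) (skew f _)).
have := congr1 (@^~ i) (dadd_intertwines v); rewrite /= -skew_intertwines.
rewrite (daddD (skew ft _) (skew f _)) => <-.
ring.
Qed.

(** By $u_2(D_x+g)v=D_x(u_2v)$ and the product rule. Hence $D_x^{-1}u_1D_xq=u_1q-u_2v$ is local. *)
Lemma dmul_dadd v : let q := dadd v in
  (fun i => u1 * dmul q i) = dmul (fun i => u1 * q i - u2 * v i).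
Proof. apply: funext => i /=; rewrite /dadd /dmul !derE -gu2; ring. Qed.

(** Here $z$ plays $D_x^{-1}u_1D_xy$ and enters only through its derivative, so $D_xD_K$ is
    local. *)
Lemma dmul_frechet y z : dmul z = (fun i => u1 * dmul y i) ->
  dmul (fun i => 2 * u * dmul y i + 2 * u1 * y i - 2 * z i)
  = fun i => 2 * u * dmul (dmul y) i + 2 * u1 * dmul y i + 2 * u2 * y i.
Proof.
move=> dz; apply: funext => i; have {dz} := congr1 (@^~ i) dz; rewrite /dmul !derE => dz.
have -> : z (i - 1) = u1 * (der (y i) + y (i - 1)) - der (z i) by rewrite -dz; ring.
ring.
Qed.

Lemma dadd_skewN (a : B) y i :
  dadd (skew f (fun j => - (a * y j))) i = - dadd (skew f (fun j => a * y j)) i.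
Proof. rewrite /dadd /skew /dmul !derE; ring. Qed.

End Intertwining.

(** * Operators as maps on coefficient families *)

Section Action.
Variable B : diffRingType.
Implicit Types (P Q : pdo B) (phi psi : (int -> B) -> int -> B).

(** Nuclearity is bundled in so that products of operators act by composition. *)
Definition acts P phi :=
  nuclear P /\ forall Q, pdo_coef (P * Q)%pdo = phi (pdo_coef Q).

Lemma acts_ext P P' phi phi' :
  pdo_coef P = pdo_coef P' -> phi =2 phi' -> acts P phi -> acts P' phi'.
Proof.
move=> eqP eqphi [nP aP]; split=> [Q Z | Q].
  rewrite -(coef_mul_congr eqP (erefl (pdo_coef (Q * Z)%pdo))) -nP.
  by apply: coef_mul_congr => //; apply: coef_mul_congr.
rewrite -(coef_mul_congr eqP (erefl (pdo_coef Q))) aP.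
by apply: funext => i; rewrite eqphi.
Qed.

Lemma acts_mulop b : acts (mulop b) (fun y i => b * y i).
Proof.
by split=> [|Q]; [exact: nuclear_mulop | apply: funext => i; rewrite coef_mulop_mul].
Qed.

Lemma acts_Dx : acts Dx (@dmul B).
Proof. by split=> [|Q]; [exact: nuclear_Dx | rewrite coef_Dx_mul]. Qed.

Lemma acts_add P Q phi psi :
  acts P phi -> acts Q psi -> acts (P + Q)%pdo (fun y i => phi y i + psi y i).
Proof.
move=> [nP aP] [nQ aQ]; split=> [|Z]; first exact: nuclear_add.
by apply: funext => i; rewrite coef_mulDl aP aQ.
Qed.

Lemma acts_opp P phi : acts P phi -> acts (pdo_opp P) (fun y i => - phi y i).
Proof.
move=> [nP aP]; split=> [|Z]; first exact: nuclear_opp.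
by apply: funext => i; rewrite coef_mulNl aP.
Qed.

Lemma acts_mul P Q phi psi :
  acts P phi -> acts Q psi -> acts (P * Q)%pdo (fun y => phi (psi y)).
Proof.
by move=> [nP aP] [nQ aQ]; split=> [|Z]; [exact: nuclear_mul | rewrite nP aP aQ].
Qed.

Lemma coef_mul0r P Q : pdo_coef Q = (fun=> 0) -> pdo_coef (P * Q)%pdo = fun=> 0.
Proof.
move=> Q0; apply: funext => i.
pose N := (`|pdo_top P| + `|pdo_top Q| + `|i|).+1%N.
rewrite (@coef_mulE _ P Q (pdo_top P) N N); try by rewrite /N; lia.
by rewrite Q0 big1 // => a _; rewrite dpow_eq0 ?mulr0.
Qed.

End Action.

(** * From the evolution of $f$ and $g$ to the recursion property *)

Section HunterSaxtonRecursion.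
Variables (C : fieldType) (A : jetAlgType C).
Notation NA := (nonlocal A).
Notation ev := (evol (HS_K A)).
Notation u := (loc (jet 0) : NA).
Implicit Types (P Q : pdo A) (phi phit psi psit : (int -> NA) -> int -> NA).

Let jetE : (loc (jet 1) = der u) * (loc (jet 2) = der (der u)) *
           (loc (jet 3) = der (der (der u))).
Proof. by rewrite !der_loc !der_jet. Qed.

Lemma der_locE : {morph @loc C A : f / der f}.
Proof. by move=> f; rewrite der_loc. Qed.

(* [phi] is the action of P and [phit] that of D_P[K]. *)
Definition evolves P phi phit :=
  acts (pdo_map loc P) phi /\ acts (pdo_map ev P) phit.

Lemma evolves_Dx : evolves Dx (@dmul NA) (fun _ _ => 0).
Proof.
split.
  apply: acts_ext (acts_Dx NA) => //; apply: funext => i.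
  by rewrite coef_map_pdo // !coef_Dpow loc_nat.
apply: acts_ext (acts_mulop 0) => [|y i]; last by rewrite mul0r.
apply: funext => i; rewrite coef_map_pdo ?evol0 // coef_Dpow evol_nat.
by rewrite coef_mulop mul0r.
Qed.

Lemma evolves_mulop f :
  evolves (mulop f) (fun y i => loc f * y i) (fun y i => ev f * y i).
Proof.
split; apply: acts_ext (acts_mulop _) => //; apply: funext => i;
  by rewrite coef_map_mulop ?evol0.
Qed.

Lemma evolves_add P Q phi phit psi psit :
    evolves P phi phit -> evolves Q psi psit ->
  evolves (P + Q)%pdo (fun y i => phi y i + psi y i) (fun y i => phit y i + psit y i).
Proof.
move=> [aP aPt] [aQ aQt]; split.
  apply: acts_ext (acts_add aP aQ) => //.
  by apply: funext => i; rewrite coef_map_add //; exact: locD.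
apply: acts_ext (acts_add aPt aQt) => //.
by apply: funext => i; rewrite coef_map_add ?evol0 //; exact: evolD.
Qed.

Lemma evolves_opp P phi phit : evolves P phi phit ->
  evolves (pdo_opp P) (fun y i => - phi y i) (fun y i => - phit y i).
Proof.
move=> [aP aPt]; split.
  apply: acts_ext (acts_opp aP) => //; apply: funext => i.
  by rewrite coef_opp !(coef_map_pdo (loc0 A)) coef_opp locN.
apply: acts_ext (acts_opp aPt) => //; apply: funext => i.
by rewrite coef_opp !(coef_map_pdo (evol0 _)) coef_opp evolN.
Qed.

Lemma coef_evol_mul P Q i :
  pdo_coef (pdo_map ev (P * Q)%pdo) i =
    pdo_coef (pdo_map ev P * pdo_map loc Q + pdo_map loc P * pdo_map ev Q)%pdo i.
Proof.
rewrite coef_add; apply: coef_map_derivation.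
- exact: evol0.
- exact: evolD.
- exact: evol_der.
- exact: der_locE.
exact: evolM.
Qed.

Lemma coef_loc_mul P Q :
  pdo_coef (pdo_map loc (P * Q)%pdo) = pdo_coef (pdo_map loc P * pdo_map loc Q)%pdo.
Proof.
apply: funext => i; apply: coef_map_morph => //.
- exact: locD.
- exact: der_locE.
exact: locM.
Qed.

Lemma evolves_mul P Q phi phit psi psit :
    evolves P phi phit -> evolves Q psi psit ->
  evolves (P * Q)%pdo (fun y => phi (psi y))
    (fun y i => phit (psi y) i + phi (psit y) i).
Proof.
move=> [aP aPt] [aQ aQt]; split.
  by apply: acts_ext (acts_mul aP aQ) => //; rewrite coef_loc_mul.
apply: acts_ext (acts_add (acts_mul aPt aQ) (acts_mul aP aQt)) => //.
by apply: funext => i; rewrite coef_evol_mul.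
Qed.

Lemma evolves_ext P phi phi' phit phit' :
  phi =2 phi' -> phit =2 phit' -> evolves P phi phit -> evolves P phi' phit'.
Proof. by move=> ? ? [? ?]; split; [apply: acts_ext | apply: acts_ext]; eauto. Qed.

Lemma HS_DK_mul (Q : pdo NA) i :
  pdo_coef (HS_DK A * Q)%pdo i =
    2 * u * dmul (pdo_coef Q) i + 2 * der u * pdo_coef Q i
    - 2 * pdo_coef (Dxinv * (mulop (der u) * (Dx * Q)))%pdo i.
Proof.
rewrite /HS_DK coef_mulDl coef_mulNl coef_mulDl nuclear_mulop coef_mulop_mul.
rewrite coef_Dx_mul coef_mulop_mul !locM !loc_nat jetE; congr (_ + _ - _).
have n2 : nuclear (mulop 2 * Dxinv : pdo NA)%pdo.
  exact: nuclear_mul (@nuclear_mulop _ _) (@nuclear_Dxinv _).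
rewrite (nuclear_mul n2 (@nuclear_mulop _ _)) n2 nuclear_mulop coef_mulop_mul.
by [].
Qed.

(** [Dpow 0] is the identity operator, so [y] and [x] are the coefficient families of $1$ and
    $D_x$. *)
Lemma dmul_HS_DK i : let y := pdo_coef (Dpow 0) in let x := dmul y in
  dmul (pdo_coef (HS_DK A)) i =
    2 * u * dmul x i + 2 * der u * x i + 2 * der (der u) * y i.
Proof.
move=> y x.
have coefDx : pdo_coef (Dx : pdo NA) = x.
  apply: funext => j; rewrite /x /y /dmul !coef_Dpow der_nat add0r.
  by congr (nat_of_bool _)%:R; lia.
pose z := pdo_coef (Dxinv * (mulop (der u) * Dx) : pdo NA)%pdo.
have dz : dmul z = fun j => der u * x j.
  by apply: funext => j; rewrite /z coef_Dx_Dxinv_mul coef_mulop_mul coefDx.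
have -> : pdo_coef (HS_DK A) = fun j => 2 * u * x j + 2 * der u * y j - 2 * z j.
  apply: funext => j; rewrite /HS_DK coef_add coef_opp coef_add coef_mulop_mul coefDx.
  rewrite coef_mulop -(coef_Dpow NA 0) -/y !locM !loc_nat jetE; congr (_ + _ - _).
  have n2 : nuclear (mulop 2 * Dxinv : pdo NA)%pdo.
    exact: nuclear_mul (@nuclear_mulop _ _) (@nuclear_Dxinv _).
  by rewrite n2 nuclear_mulop coef_mulop_mul.
by rewrite (dmul_frechet dz).
Qed.

Variables (f g : A).
Let lf := loc f.
Let lg := loc g.
Hypothesis gu2 : g * jet 2 = jet 3.
Hypothesis evg : ev g = loc (2 * jet 0 * der g + 2 * jet 1 * g + 4 * jet 2).
Hypothesis evf : ev f = loc (2 * jet 0 * der f - 8 * jet 1 * f).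

Lemma recursion_of_evolution :
  recursion_operator (HS_K A) (HS_DK A)
    ((Dx + mulop g) * (mulop f * Dx + Dx * mulop f) * (Dx - mulop g) * Dx)%pdo.
Proof.
have lgu2 : lg * der (der u) = der (der (der u)) by rewrite !der_loc !der_jet -locM gu2.
have E1 : evolves (Dx + mulop g) (dadd lg) (fun y i => ev g * y i).
  by apply: evolves_ext (evolves_add evolves_Dx (evolves_mulop g)) => // y i; rewrite add0r.
have E2 : evolves (Dx - mulop g) (dsub lg) (fun y i => - (ev g * y i)).
  apply: evolves_ext (evolves_add evolves_Dx (evolves_opp (evolves_mulop g))) => // y i.
  by rewrite add0r.
have EF : evolves (mulop f * Dx + Dx * mulop f) (skew lf) (skew (ev f)).
  apply: evolves_ext (evolves_add (evolves_mul (evolves_mulop f) evolves_Dx)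
    (evolves_mul evolves_Dx (evolves_mulop f))) => // y i.
  by rewrite mulr0 addr0 add0r.
have [aS aSt] := evolves_mul (evolves_mul E1 EF) E2.
set S := ((Dx + mulop g) * _ * _)%pdo in aS aSt *.
have [aD _] := evolves_Dx.
set y := pdo_coef (Dpow 0 : pdo NA); set x := dmul y.
have coefDx : pdo_coef (pdo_map loc (Dx : pdo A)) = x.
  apply: funext => j; rewrite coef_map_pdo // /x /y /dmul !coef_Dpow loc_nat der_nat add0r.
  by congr (nat_of_bool _)%:R; lia.
set w := dsub lg x; set v := skew lf w.
(* [dmul_inj] compares operators, not arbitrary families, so [v] has to come from one, namely
   $F(D_x-g)D_x$. *)
have [T defT] : exists T : pdo NA, pdo_coef T = v.
  have [[_ aF] _] := EF; have [[_ a2] _] := E2.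
  by exists (pdo_map loc (mulop f * Dx + Dx * mulop f) *
    (pdo_map loc (Dx - mulop g) * pdo_map loc Dx))%pdo; rewrite aF a2 coefDx.
have coefR : pdo_coef (pdo_map loc (S * Dx)%pdo) = dadd lg v.
  by rewrite coef_loc_mul aS.2 coefDx.
have coefRt i : pdo_coef (pdo_map ev (S * Dx)%pdo) i =
    ev g * v i + dadd lg (skew (ev f) w) i
    + dadd lg (skew lf (fun j => - (ev g * x j))) i.
  (* The last factor $D_x$ has constant coefficients and contributes nothing to the evolution. *)
  rewrite coef_evol_mul coef_add aSt.2 coefDx coef_mul0r ?addr0 //.
  by apply: funext => j; rewrite coef_map_pdo ?evol0 // coef_Dpow evol_nat.
have coefRDK : pdo_coef (pdo_map loc (S * Dx)%pdo * HS_DK A)%pdo =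
    dadd lg (skew lf (dsub lg (dmul (pdo_coef (HS_DK A))))).
  rewrite (coef_mul_congr (coef_loc_mul S Dx) (erefl (pdo_coef (HS_DK A)))).
  by rewrite (acts_mul aS aD).2.
have coefDKR i : pdo_coef (HS_DK A * pdo_map loc (S * Dx)%pdo)%pdo i =
    2 * u * dmul (dadd lg v) i + 2 * der (der u) * v i.
  rewrite HS_DK_mul coefR.
  set R' := pdo_map loc _ in coefR *.
  (* $D_x^{-1}u_1D_xR'=u_1R'-u_2T$ is checked after applying $D_x$; its $u_1R'$ then cancels the
     term $2u_1R'$ of $D_KR'$. *)
  have -> : pdo_coef (Dxinv * (mulop (der u) * (Dx * R')))%pdo
      = pdo_coef (mulop (der u) * R' - mulop (der (der u)) * T)%pdo.
    apply: dmul_inj; rewrite coef_Dx_Dxinv_mul.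
    have -> : pdo_coef (mulop (der u) * R' - mulop (der (der u)) * T)%pdo =
        fun i => der u * dadd lg v i - der (der u) * v i.
      by apply: funext => j; rewrite coef_add coef_opp !coef_mulop_mul coefR defT.
    rewrite -dmul_dadd //.
    by apply: funext => j; rewrite coef_mulop_mul coef_Dx_mul coefR.
  rewrite coef_add coef_opp !coef_mulop_mul coefR defT; ring.
move=> i; rewrite !coef_add coef_opp coefRt coefDKR coefRDK.
have -> : dmul (pdo_coef (HS_DK A)) = fun i =>
    2 * u * dmul x i + 2 * der u * x i + 2 * der (der u) * y i.
  by apply: funext => j; rewrite dmul_HS_DK.
rewrite dadd_skewN.
have -> : ev g = 2 * u * der lg + 2 * der u * lg + 4 * der (der u).
  by rewrite evg !locD !locM !loc_nat !jetE der_locE.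
have -> : ev f = 2 * u * der lf - 8 * der u * lf.
  by rewrite evf locD locN !locM !loc_nat jetE der_locE.
exact: recursion_identity.
Qed.

End HunterSaxtonRecursion.

Theorem corollary2 (R : realType) (A : jetAlgType R[i]) (alpha : R[i]) :
  let g : A := jet 3 / jet 2 in
  let f : A := (4 * jet 2 ^+ 2 - jet 1 * jet 3)
                 / (jpow 1 (4 * alpha - 5) * jpow 2 (5 - alpha)) in
  recursion_operator (HS_K A) (HS_DK A)
    ((Dx + mulop g) * (mulop f * Dx + Dx * mulop f) * (Dx - mulop g) * Dx)%pdo.
Proof.
move=> g f; apply: recursion_of_evolution.
- by rewrite /g divrK // jet_unit.
- exact: evol_g.
by rewrite (weight_f A alpha) !mulNr.
Qed.
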